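(* Consider an electrical circuit composed of conductances, inductances, capacitances and sources, with underlying finite loop-free directed graph $\mathcal{G}$ with $n$ vertices and $m$ edges, and with a set $S$ of grounded vertices containing at most one vertex from each connected component of $\mathcal{G}$. Let $A\in\mathbb{R}^{(n-|S|)\times m}$ be obtained from the incidence matrix of $\mathcal{G}$ by deleting the rows corresponding to $S$, with edges ordered such that $A=\begin{bmatrix}A_R&A_L&A_C&A_S\end{bmatrix}$, where the $m_R,m_L,m_C,m_S$ columns of the blocks correspond to the edges of conductances, inductances, capacitances and sources, respectively ($m=m_R+m_L+m_C+m_S$). Then the interconnection \[ (\mathcal{D},\mathcal{L},\mathcal{R})=(\mathcal{D}^S_K(\mathcal{G}),\mathcal{L}^S_K(\mathcal{G}),\{0\})\circ\left(\text{Cartesian product of all component systems}\right) \] with respect to the linking space $(\mathbb{R}^m,\mathbb{R}^m)$ of edge currents and edge voltages is given (up to the ordering of the variables) by \[ \begin{aligned} \mathcal{D}=\Big\{&(j,-u_L,-i_C,-i_R,-i_S,\phi,i_L,u_C,u_R,u_S)\in\mathbb{R}^{n-|S|}\times\mathbb{R}^m\times\mathbb{R}^{n-|S|}\times\mathbb{R}^m \;\Big| \\ &\begin{bmatrix} I&0&A_C&A_R&A_S \\ 0&0&0&0&0 \\ 0&-I&0&0&0 \\ 0&0&0&0&0 \\ 0&0&0&0&0 \end{bmatrix}\begin{pmatrix} j \\ -u_L \\ -i_C \\ -i_R \\ -i_S \end{pmatrix}+\begin{bmatrix} 0&-A_L&0&0&0 \\ -A_R^\top&0&0&I&0 \\ -A_L^\top&0&0&0&0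 \\ -A_C^\top&0&I&0&0 \\ -A_S^\top&0&0&0&I \end{bmatrix}\begin{pmatrix} \phi \\ i_L \\ u_C \\ u_R \\ u_S \end{pmatrix}=0\Big\}, \end{aligned} \] where the energy-storing flows and efforts are $(j,-u_L,-i_C)$ and $(\phi,i_L,u_C)$, the resistive ones are $-i_R$ and $u_R$, and the external ones are $-i_S$ and $u_S$, together with \[ \mathcal{L}=\left\{(q,\psi_L,q_C,\phi,i_L,u_C) \;\middle|\; q=0,\ i_L=\nabla H_L(\psi_L),\ u_C=\nabla H_C(q_C)\right\}\subset(\mathbb{R}^{n-|S|}\times\mathbb{R}^{m_L}\times\mathbb{R}^{m_C})^2, \] \[ \mathcal{R}=\{(-i_R,u_R)\in\mathbb{R}^{m_R}\times\mathbb{R}^{m_R}\mid i_R=g(u_R)\}. \]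
   Context: Graphs. A directed graph $(V,E,\mathrm{init},\mathrm{ter})$ has maps $\mathrm{init},\mathrm{ter}:E\to V$; it is loop-free if $\mathrm{init}(e)\neq\mathrm{ter}(e)$ for all $e$. The incidence matrix has entry $1$ at $(v,e)$ if $\mathrm{init}(e)=v$, $-1$ if $\mathrm{ter}(e)=v$, and $0$ otherwise. Each edge of $\mathcal{G}$ corresponds to exactly one port of exactly one component. Systems. A port-Hamiltonian system is a triple $(\mathcal{D},\mathcal{L},\mathcal{R})$ of a Dirac structure $\mathcal{D}\subset(\mathcal{F}_{\mathcal L}\times\mathcal{F}_{\mathcal R}\times\mathcal{F}_{\mathcal P})\times(\mathcal{E}_{\mathcal L}\times\mathcal{E}_{\mathcal R}\times\mathcal{E}_{\mathcal P})$ (energy-storing, resistive, external flows and efforts, with $\mathcal{F}_\bullet=\mathcal{E}_\bullet=\mathbb{R}^{n_\bullet}$), a Lagrange submanifold $\mathcal{L}\subset\mathcal{F}_{\mathcal L}\times\mathcal{E}_{\mathcal L}$ and a resistive relation $\mathcal{R}\subset\mathcal{F}_{\mathcal R}\times\mathcal{E}_{\mathcal R}$ (i.e. $e^\top f\le 0$ for all $(f,e)\in\mathcal{R}$). Absent parts are trivial (zero-dimensional), written $\{0\}$. Interconnection. Suppose the external variables of two systems ($k=1,2$) split into a specific part $(f_{\mathcal Pk},e_{\mathcal Pk})$ and a to-be-linked part in a common space $\mathcal{F}_{\rm link}\times\mathcal{E}_{\rm link}$. Then $(\mathcal{D}_1,\mathcal{L}_1,\mathcal{R}_1)\circ(\mathcal{D}_2,\mathcal{L}_2,\mathcal{R}_2)=(\mathcal{D},\mathcal{L},\mathcal{R})$,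 where $\mathcal{D}$ is the set of all $((f_{\mathcal L1},f_{\mathcal L2}),(f_{\mathcal R1},f_{\mathcal R2}),(f_{\mathcal P1},f_{\mathcal P2}),(e_{\mathcal L1},e_{\mathcal L2}),(e_{\mathcal R1},e_{\mathcal R2}),(e_{\mathcal P1},e_{\mathcal P2}))$ for which there exists $(f_{\rm link},e_{\rm link})$ with $(f_{\mathcal L1},f_{\mathcal R1},f_{\mathcal P1},f_{\rm link},e_{\mathcal L1},e_{\mathcal R1},e_{\mathcal P1},e_{\rm link})\in\mathcal{D}_1$ and $(f_{\mathcal L2},f_{\mathcal R2},f_{\mathcal P2},-f_{\rm link},e_{\mathcal L2},e_{\mathcal R2},e_{\mathcal P2},e_{\rm link})\in\mathcal{D}_2$; and $\mathcal{L}$, $\mathcal{R}$ are the (reordered) Cartesian products of $\mathcal{L}_1,\mathcal{L}_2$ and of $\mathcal{R}_1,\mathcal{R}_2$. The Cartesian product of systems is the interconnection with trivial linking space $\{0\}$. Kirchhoff system. $\mathcal{D}^S_K(\mathcal{G})=\{(j,i,\phi,u)\in\mathbb{R}^{n-|S|}\times\mathbb{R}^m\times\mathbb{R}^{n-|S|}\times\mathbb{R}^m\mid j+Ai=0,\ A^\top\phi-u=0\}$ with energy-storing flow/effort $j,\phi$ and linking flow/effort $i,u$; $\mathcal{L}^S_K(\mathcal{G})=\{0\}\times\mathbb{R}^{n-|S|}$; trivial resistive relation. Components (a component with $\ell$ ports uses variables in $\mathbb{R}^\ell$; its linking flow is the current and its linking effort is the voltage on its $\ell$ edges). Conductance: Dirac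 structure $\{(-i,i,u,u)\mid i,u\in\mathbb{R}^\ell\}$ with resistive flow $-i$, linking flow $i$, resistive effort $u$, linking effort $u$; trivial Lagrange submanifold; resistive relation $\{(-i,u)\mid i=g_k(u)\}$, where $g_k:\mathbb{R}^\ell\to\mathbb{R}^\ell$ satisfies $u^\top g_k(u)\ge0$ for all $u$. Inductance: Dirac structure $\{(-u,i,i,u)\mid i,u\in\mathbb{R}^\ell\}$ with energy-storing flow $-u$, linking flow $i$, energy-storing effort $i$, linking effort $u$; Lagrange submanifold $\{(\psi,i)\mid i=\nabla H_{L,k}(\psi)\}$ with $H_{L,k}\in C^1(\mathbb{R}^\ell,\mathbb{R})$; trivial resistive relation. Capacitance: Dirac structure $\{(-i,i,u,u)\mid i,u\in\mathbb{R}^\ell\}$ with energy-storing flow $-i$, linking flow $i$, energy-storing effort $u$, linking effort $u$; Lagrange submanifold $\{(q,u)\mid u=\nabla H_{C,k}(q)\}$ with $H_{C,k}\in C^1(\mathbb{R}^\ell,\mathbb{R})$; trivial resistive relation. Source (one port): Dirac structure $\{(-i,i,u,u)\mid i,u\in\mathbb{R}\}$ with specific external flow $-i$, linking flow $i$, specific external effort $u$, linking effort $u$; trivial Lagrange submanifold and resistive relation. Stacked notation. $i_R,u_R\in\mathbb{R}^{m_R}$, $i_L,u_L,\psi_L\in\mathbb{R}^{m_L}$, $i_C,u_C,q_C\in\mathbb{R}^{m_C}$, $i_S,u_S\in\mathbb{R}^{m_S}$ stack the variables of all components of each type; $g$ is the stacked map of the $g_k$; $H_L(\psi_L)=\sum_k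 H_{L,k}(\psi_{L,k})$ and $H_C(q_C)=\sum_k H_{C,k}(q_{C,k})$. *)

(* Defs.v *)
From HB Require Import structures.
From mathcomp Require Import all_boot all_order all_algebra.
From mathcomp Require Import all_classical all_reals all_analysis.

Set Implicit Arguments.
Unset Strict Implicit.
Unset Printing Implicit Defensive.

Import Order.TTheory GRing.Theory Num.Theory.
Import numFieldNormedType.Exports.

Local Open Scope classical_set_scope.
Local Open Scope ring_scope.

(* Dimension of the space that stacks the blocks k, of dimension l k each;
   this is the shape of \mxcol_k x_k with x_k : 'cV_(l k). *)
Notation stacked l := (\sum_k l k)%N (only parsing).

Record digraph (V E : finType) := Digraph { init : E -> V; ter : E -> V }.

Section Graphs.
Variables (V E : finType) (G : digraph V E).

Definition loop_free : Prop := forall e, init G e != ter G e.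

(* x and y are joined by an edge, in either direction, so that
   [connect joined] is membership in the same connected component. *)
Definition joined : rel V := [rel x y |
  [exists e, ((init G e == x) && (ter G e == y)) ||
             ((init G e == y) && (ter G e == x))]].

Definition one_grounded_per_component (S : {set V}) : Prop :=
  {in S &, forall x y, connect joined x y -> x = y}.

(* Incidence matrix without the rows of S: its rows are numbered by the
   enumeration of the n - |S| vertices of ~: S, and its columns by
   [edge : 'I_m -> E]. *)
Definition reduced_incidence (R : realType) (S : {set V}) (m : nat)
    (edge : 'I_m -> E) : 'M[R]_(#|~: S|, m) :=
  \matrix_(i, j) (if init G (edge j) == enum_val i then 1
                  else if ter G (edge j) == enum_val i then -1 else 0).

End Graphs.

Section PortHamiltonian.
Variable R : realType.

Definition gradient (l : nat) (H : 'cV[R]_l -> R) (x : 'cV[R]_l) : 'cV[R]_l :=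
  \col_k 'D_(delta_mx k 0) H x.

Definition C1 (l : nat) (H : 'cV[R]_l -> R) : Prop :=
  (forall x, differentiable H x) /\ continuous (gradient H).

(* The triple (D, L, R) of a system with l energy-storing, r resistive and p
   external variables; D consists of pairs (flows, efforts), each ordered as
   (energy-storing, resistive, external).  Interconnection makes sense for
   arbitrary relations, so that D being a Dirac structure, L a Lagrange
   submanifold and R a resistive relation are not part of the record. *)
Record phs (l r p : nat) := Phs {
  dirac_structure : set (('cV[R]_l * 'cV[R]_r * 'cV[R]_p) *
               ('cV[R]_l * 'cV[R]_r * 'cV[R]_p));
  lagrange_submanifold : set ('cV[R]_l * 'cV[R]_l);
  resistive_relation : set ('cV[R]_r * 'cV[R]_r) }.

(* The external variables of both systems are split as (specific, link), with
   a common linking space of dimension k. *)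
Definition interconnect (l1 r1 p1 l2 r2 p2 k : nat)
    (S1 : phs l1 r1 (p1 + k)) (S2 : phs l2 r2 (p2 + k)) :
    phs (l1 + l2) (r1 + r2) (p1 + p2) := {|
  dirac_structure := [set x | let: ((fL, fR, fP), (eL, eR, eP)) := x in
    exists flink elink : 'cV[R]_k,
      dirac_structure S1
        ((usubmx fL, usubmx fR, col_mx (usubmx fP) flink),
         (usubmx eL, usubmx eR, col_mx (usubmx eP) elink)) /\
      dirac_structure S2
        ((dsubmx fL, dsubmx fR, col_mx (dsubmx fP) (- flink)),
         (dsubmx eL, dsubmx eR, col_mx (dsubmx eP) elink))];
  lagrange_submanifold := [set x |
    lagrange_submanifold S1 (usubmx x.1, usubmx x.2) /\
    lagrange_submanifold S2 (dsubmx x.1, dsubmx x.2)];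
  resistive_relation := [set x |
    resistive_relation S1 (usubmx x.1, usubmx x.2) /\
    resistive_relation S2 (dsubmx x.1, dsubmx x.2)] |}.

(* Change of coordinates: the maps send the new variables to the old ones.  It
   is only applied to maps that reorder blocks and add or drop blocks of
   dimension zero, the same map being used for flows and for efforts. *)
Definition reorder (l r p l' r' p' : nat)
    (aL : 'cV[R]_l' -> 'cV[R]_l) (aR : 'cV[R]_r' -> 'cV[R]_r)
    (aP : 'cV[R]_p' -> 'cV[R]_p) (S : phs l r p) : phs l' r' p' := {|
  dirac_structure := [set x | let: ((fL, fR, fP), (eL, eR, eP)) := x in
    dirac_structure S ((aL fL, aR fR, aP fP), (aL eL, aR eR, aP eP))];
  lagrange_submanifold := [set x | lagrange_submanifold S (aL x.1, aL x.2)];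
  resistive_relation := [set x | resistive_relation S (aR x.1, aR x.2)] |}.

Definition no_link (l r p : nat) : phs l r p -> phs l r (p + 0) :=
  reorder id id usubmx.

Definition cartesian2 (l1 r1 p1 l2 r2 p2 : nat)
    (S1 : phs l1 r1 p1) (S2 : phs l2 r2 p2) :
    phs (l1 + l2) (r1 + r2) (p1 + p2) :=
  interconnect (no_link S1) (no_link S2).

Definition split_first (N : nat) (d : 'I_N.+1 -> nat)
    (x : 'cV[R]_(stacked d)) :
    'cV[R]_(d ord0 + \sum_(k < N) d (lift ord0 k)) :=
  col_mx (submxcol x ord0) (\mxcol_(k < N) submxcol x (lift ord0 k)).

(* Iterated product; the variables of the factors are stacked blockwise. *)
Fixpoint cartesian (N : nat) : forall (l r p : 'I_N -> nat),
    (forall k, phs (l k) (r k) (p k)) ->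
    phs (stacked l) (stacked r) (stacked p) :=
  match N with
  | 0 => fun _ _ _ _ => Phs [set 0] [set 0] [set 0]
  | N'.+1 => fun l r p S =>
      reorder (@split_first N' l) (@split_first N' r) (@split_first N' p)
        (cartesian2 (S ord0) (cartesian (fun k => S (lift ord0 k))))
  end.

(* In all systems below the external variables are ordered as
   (specific, link). *)

(* The Kirchhoff system of a reduced incidence matrix A. *)
Definition kirchhoff (v m : nat) (A : 'M[R]_(v, m)) : phs v 0 (0 + m) := {|
  dirac_structure := [set x | exists j i phi u,
    [/\ x = ((j, 0, col_mx 0 i), (phi, 0, col_mx 0 u)),
        j + A *m i = 0 & A^T *m phi - u = 0]];
  lagrange_submanifold := [set x | x.1 = 0];
  resistive_relation := [set 0] |}.

Definition conductance (l : nat) (g : 'cV[R]_l -> 'cV[R]_l) :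
    phs 0 l (0 + l) := {|
  dirac_structure := [set x | exists i u,
    x = ((0, - i, col_mx 0 i), (0, u, col_mx 0 u))];
  lagrange_submanifold := [set 0];
  resistive_relation := [set x | exists i u, x = (- i, u) /\ i = g u] |}.

Definition inductance (l : nat) (H : 'cV[R]_l -> R) : phs l 0 (0 + l) := {|
  dirac_structure := [set x | exists i u,
    x = ((- u, 0, col_mx 0 i), (i, 0, col_mx 0 u))];
  lagrange_submanifold := [set x |
    exists psi i, x = (psi, i) /\ i = gradient H psi];
  resistive_relation := [set 0] |}.

Definition capacitance (l : nat) (H : 'cV[R]_l -> R) : phs l 0 (0 + l) := {|
  dirac_structure := [set x | exists i u,
    x = ((- i, 0, col_mx 0 i), (u, 0, col_mx 0 u))];
  lagrange_submanifold := [set x |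
    exists q u, x = (q, u) /\ u = gradient H q];
  resistive_relation := [set 0] |}.

Definition source : phs 0 0 (1 + 1) := {|
  dirac_structure := [set x | exists i u : 'cV[R]_1,
    x = ((0, 0, col_mx (- i) i), (0, 0, col_mx u u))];
  lagrange_submanifold := [set 0];
  resistive_relation := [set 0] |}.

Definition stack_map (N : nat) (l : 'I_N -> nat)
    (g : forall k, 'cV[R]_(l k) -> 'cV[R]_(l k)) (x : 'cV[R]_(stacked l)) :
    'cV[R]_(stacked l) :=
  \mxcol_k g k (submxcol x k).

Definition stack_sum (N : nat) (l : 'I_N -> nat)
    (H : forall k, 'cV[R]_(l k) -> R) (x : 'cV[R]_(stacked l)) : R :=
  \sum_k H k (submxcol x k).

Section Components.
Variables (NR NL NC NS : nat).
Variables (lR : 'I_NR -> nat) (lL : 'I_NL -> nat) (lC : 'I_NC -> nat).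
Variable g : forall k, 'cV[R]_(lR k) -> 'cV[R]_(lR k).
Variable HL : forall k, 'cV[R]_(lL k) -> R.
Variable HC : forall k, 'cV[R]_(lC k) -> R.

Definition product_of_components :=
  cartesian2 (cartesian (fun k => conductance (@g k)))
 (cartesian2 (cartesian (fun k => inductance (@HL k)))
 (cartesian2 (cartesian (fun k => capacitance (@HC k)))
             (cartesian (fun _ : 'I_NS => source)))).

(* The zero blocks below live in the spaces of dimension \sum_k 0 that the
   product contains for the absent variables of its factors. *)
Definition order_storage (x : 'cV[R]_(stacked lL + stacked lC)) :
    'cV[R]_(\sum_(k < NR) 0 + (stacked lL + (stacked lC + \sum_(k < NS) 0))) :=
  col_mx 0 (col_mx (usubmx x) (col_mx (dsubmx x) 0)).

Definition order_resistive (x : 'cV[R]_(stacked lR)) :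
    'cV[R]_(stacked lR +
      (\sum_(k < NL) 0 + (\sum_(k < NC) 0 + \sum_(k < NS) 0))) :=
  col_mx x 0.

(* x consists of the specific variables s of the sources, followed by the
   linking variables of the conductances, inductances, capacitances and
   sources; in the product, s and the linking variables of the sources are
   interleaved. *)
Definition order_external
    (x : 'cV[R]_(NS + (stacked lR + (stacked lL + (stacked lC + NS))))) :
    'cV[R]_(stacked lR + (stacked lL + (stacked lC + \sum_(k < NS) (1 + 1)))) :=
  let s := usubmx x in
  let link := dsubmx x in
  let linkR := usubmx link in
  let linkL := usubmx (dsubmx link) in
  let linkC := usubmx (dsubmx (dsubmx link)) in
  let linkS := dsubmx (dsubmx (dsubmx link)) in
  col_mx linkR (col_mx linkL (col_mx linkC
    (\mxcol_(k < NS) col_mx (row k s) (row k linkS)))).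

Definition components : phs (stacked lL + stacked lC) (stacked lR)
    (NS + (stacked lR + (stacked lL + (stacked lC + NS)))) :=
  reorder order_storage order_resistive order_external product_of_components.

End Components.

Section BlockMatrices.
Variables (v mR mL mC mS : nat).
Variables (AR : 'M[R]_(v, mR)) (AL : 'M[R]_(v, mL)).
Variables (AC : 'M[R]_(v, mC)) (AS : 'M[R]_(v, mS)).

Definition row5 (n : nat) (B1 : 'M[R]_(n, v)) (B2 : 'M[R]_(n, mL))
    (B3 : 'M[R]_(n, mC)) (B4 : 'M[R]_(n, mR)) (B5 : 'M[R]_(n, mS)) :
    'M[R]_(n, v + (mL + (mC + (mR + mS)))) :=
  row_mx B1 (row_mx B2 (row_mx B3 (row_mx B4 B5))).

Definition flow_matrix :
    'M[R]_(v + (mR + (mL + (mC + mS))), v + (mL + (mC + (mR + mS)))) :=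
  col_mx         (row5 1%:M 0       AC AR AS)
  (col_mx        (row5 0    0       0  0  0)
  (col_mx        (row5 0    (- 1%:M) 0  0  0)
  (col_mx        (row5 0    0       0  0  0)
                 (row5 0    0       0  0  0)))).

Definition effort_matrix :
    'M[R]_(v + (mR + (mL + (mC + mS))), v + (mL + (mC + (mR + mS)))) :=
  col_mx         (row5 0         (- AL) 0    0    0)
  (col_mx        (row5 (- AR^T)  0      0    1%:M 0)
  (col_mx        (row5 (- AL^T)  0      0    0    0)
  (col_mx        (row5 (- AC^T)  0      1%:M 0    0)
                 (row5 (- AS^T)  0      0    0    1%:M)))).

Definition stack5 (x1 : 'cV[R]_v) (x2 : 'cV[R]_mL) (x3 : 'cV[R]_mC)
    (x4 : 'cV[R]_mR) (x5 : 'cV[R]_mS) :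
    'cV[R]_(v + (mL + (mC + (mR + mS)))) :=
  col_mx x1 (col_mx x2 (col_mx x3 (col_mx x4 x5))).

End BlockMatrices.

Arguments flow_matrix {v mR} mL {mC mS}.

End PortHamiltonian.

(* Main.v *)
Require Import Defs.
From HB Require Import structures.
From mathcomp Require Import all_boot all_order all_algebra.
From mathcomp Require Import all_classical all_reals all_analysis.

Set Implicit Arguments.
Unset Strict Implicit.
Unset Printing Implicit Defensive.

Import Order.TTheory GRing.Theory Num.Theory.
Import numFieldNormedType.Exports.

Local Open Scope classical_set_scope.
Local Open Scope ring_scope.

(** The component relations express the linking currents and voltages through
    the port variables, so that the existential quantifier of the
    interconnection can be eliminated by substitution into Kirchhoff's laws.
    The components receive the negated linking current of the Kirchhoff system;
    for the inductances this current is an effort, whence the block [- A_L] of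
    the effort matrix. *)

(** Since [0 + l] reduces to [l], the equation is typable without a cast; the empty block shifts
    indices by zero. *)
Lemma col0mx (R : realType) (l : nat) (z : 'cV[R]_0) (x : 'cV[R]_l) :
  col_mx z x = x.
Proof.
apply/matrixP => i j; rewrite mxE.
by case: splitP => [[]//|k ik]; congr (x _ _); apply: val_inj.
Qed.

Lemma dsub0mx (R : realType) (l : nat) (x : 'cV[R]_(0 + l)) : dsubmx x = x.
Proof. by rewrite -[RHS](vsubmxK x) col0mx. Qed.

(** * Iterated Cartesian products of systems *)

Section Cartesian.
Variable R : realType.

Lemma usubmx_split_first (N : nat) (d : 'I_N.+1 -> nat)
    (x : 'cV[R]_(stacked d)) : usubmx (split_first x) = submxcol x ord0.
Proof. by rewrite /split_first col_mxKu. Qed.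

Lemma submxcol_dsubmx_split_first (N : nat) (d : 'I_N.+1 -> nat)
    (x : 'cV[R]_(stacked d)) (k : 'I_N) :
  submxcol (dsubmx (split_first x)) k = submxcol x (lift ord0 k).
Proof. by rewrite /split_first col_mxKd mxcolK. Qed.

Lemma forall_ord_recl (N : nat) (P : 'I_N.+1 -> Prop) :
  (forall k, P k) <-> P ord0 /\ forall k, P (lift ord0 k).
Proof.
split=> [Pk|[P0 Pl] k]; first by split.
by case: (unliftP ord0 k) => [j|] ->.
Qed.

Lemma stacked0_eq (d : 'I_0 -> nat) (x y : 'cV[R]_(stacked d)) : x = y.
Proof. by apply/mxcolP; case. Qed.

(** The linking space has dimension zero: [no_link] drops the quantified linking variables, so any
    witness will do. *)
Lemma cartesian2_dirac (l1 r1 p1 l2 r2 p2 : nat)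
    (S1 : phs R l1 r1 p1) (S2 : phs R l2 r2 p2) fL fR fP eL eR eP :
  dirac_structure (cartesian2 S1 S2) ((fL, fR, fP), (eL, eR, eP)) <->
  dirac_structure S1 ((usubmx fL, usubmx fR, usubmx fP),
                      (usubmx eL, usubmx eR, usubmx eP)) /\
  dirac_structure S2 ((dsubmx fL, dsubmx fR, dsubmx fP),
                      (dsubmx eL, dsubmx eR, dsubmx eP)).
Proof.
rewrite /cartesian2 /=; split=> [[i [u]]|S12]; first by rewrite !col_mxKu.
by exists 0, 0; rewrite !col_mxKu.
Qed.

Lemma cartesian_dirac (N : nat) (l r p : 'I_N -> nat)
    (S : forall k, phs R (l k) (r k) (p k)) fL fR fP eL eR eP :
  dirac_structure (cartesian S) ((fL, fR, fP), (eL, eR, eP)) <->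
  forall k, dirac_structure (S k)
    ((submxcol fL k, submxcol fR k, submxcol fP k),
     (submxcol eL k, submxcol eR k, submxcol eP k)).
Proof.
elim: N l r p S fL fR fP eL eR eP => [|N IHN] l r p S fL fR fP eL eR eP.
  (* The empty product is [[set 0]], and a stack of no blocks has only one vector. *)
  split=> [_ []//|_]; rewrite /=.
  by congr ((_, _, _), (_, _, _)); apply: stacked0_eq.
(* [reorder] unfolds by conversion, so a product of [N.+1] factors is a binary product evaluated at
   the [split_first] vectors. *)
rewrite forall_ord_recl; apply: iff_trans (cartesian2_dirac _ _ _ _ _ _ _ _) _.
rewrite IHN !usubmx_split_first.
by under eq_forall do rewrite !submxcol_dsubmx_split_first.
Qed.

Lemma cartesian_lagrange (N : nat) (l r p : 'I_N -> nat)
    (S : forall k, phs R (l k) (r k) (p k)) f e :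
  lagrange_submanifold (cartesian S) (f, e) <->
  forall k, lagrange_submanifold (S k) (submxcol f k, submxcol e k).
Proof.
elim: N l r p S f e => [|N IHN] l r p S f e.
  split=> [_ []//|_]; rewrite /=.
  by congr (_, _); apply: stacked0_eq.
rewrite forall_ord_recl /= IHN !usubmx_split_first.
by under eq_forall do rewrite !submxcol_dsubmx_split_first.
Qed.

Lemma cartesian_resistive (N : nat) (l r p : 'I_N -> nat)
    (S : forall k, phs R (l k) (r k) (p k)) f e :
  resistive_relation (cartesian S) (f, e) <->
  forall k, resistive_relation (S k) (submxcol f k, submxcol e k).
Proof.
elim: N l r p S f e => [|N IHN] l r p S f e.
  split=> [_ []//|_]; rewrite /=.
  by congr (_, _); apply: stacked0_eq.
rewrite forall_ord_recl /= IHN !usubmx_split_first.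
by under eq_forall do rewrite !submxcol_dsubmx_split_first.
Qed.

End Cartesian.

(* The external spaces of dimension 0 + l below are identified with those of
   dimension l by conversion. *)
Section Factors.
Variable R : realType.

(** * Dirac structures of the single systems *)

Lemma kirchhoff_dirac (v m : nat) (A : 'M[R]_(v, m)) j (fR : 'cV[R]_0)
    (i : 'cV[R]_m) phi (eR : 'cV[R]_0) (u : 'cV[R]_m) :
  dirac_structure (kirchhoff A) ((j, fR, i), (phi, eR, u)) <->
  j + A *m i = 0 /\ A^T *m phi = u.
Proof.
split=> [[j' [i' [phi' [u' [[-> _ -> -> _ ->]]]]]]|[ji uphi]].
  by rewrite !col0mx => -> /subr0_eq.
exists j, i, phi, u; rewrite !col0mx uphi subrr ji; split=> //.
by rewrite (flatmx0 fR) (flatmx0 eR).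
Qed.

Lemma conductance_dirac (l : nat) (g : 'cV[R]_l -> 'cV[R]_l)
    (fL : 'cV[R]_0) fR (fP : 'cV[R]_l) (eL : 'cV[R]_0) eR (eP : 'cV[R]_l) :
  dirac_structure (conductance g) ((fL, fR, fP), (eL, eR, eP)) <->
  fR = - fP /\ eR = eP.
Proof.
split=> [[i [u [_ -> -> _ -> ->]]]|[-> ->]]; first by rewrite !col0mx.
by exists fP, eP; rewrite !col0mx (flatmx0 fL) (flatmx0 eL).
Qed.

Lemma inductance_dirac (l : nat) (H : 'cV[R]_l -> R)
    fL (fR : 'cV[R]_0) (fP : 'cV[R]_l) eL (eR : 'cV[R]_0) (eP : 'cV[R]_l) :
  dirac_structure (inductance H) ((fL, fR, fP), (eL, eR, eP)) <->
  fL = - eP /\ eL = fP.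
Proof.
split=> [[i [u [-> _ -> -> _ ->]]]|[-> ->]]; first by rewrite !col0mx.
by exists fP, eP; rewrite !col0mx (flatmx0 fR) (flatmx0 eR).
Qed.

Lemma capacitance_dirac (l : nat) (H : 'cV[R]_l -> R)
    fL (fR : 'cV[R]_0) (fP : 'cV[R]_l) eL (eR : 'cV[R]_0) (eP : 'cV[R]_l) :
  dirac_structure (capacitance H) ((fL, fR, fP), (eL, eR, eP)) <->
  fL = - fP /\ eL = eP.
Proof.
split=> [[i [u [-> _ -> -> _ ->]]]|[-> ->]]; first by rewrite !col0mx.
by exists fP, eP; rewrite !col0mx (flatmx0 fR) (flatmx0 eR).
Qed.

Lemma source_dirac (fL fR : 'cV[R]_0) fP (eL eR : 'cV[R]_0) eP :
  dirac_structure (source R) ((fL, fR, fP), (eL, eR, eP)) <->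
  usubmx fP = - dsubmx fP /\ usubmx eP = dsubmx eP.
Proof.
split=> [[i [u [_ _ -> _ _ ->]]]|[fPE ePE]].
  by rewrite !col_mxKu !col_mxKd.
exists (dsubmx fP), (dsubmx eP); rewrite -fPE -{1}ePE !vsubmxK.
by rewrite (flatmx0 fL) (flatmx0 eL) (flatmx0 fR) (flatmx0 eR).
Qed.

(* Moving along a coordinate axis changes a single summand of stack_sum H, and
   this by exactly the difference quotient of that summand: the derivatives
   agree even where they are junk. *)
Lemma gradient_stack_sum (N : nat) (l : 'I_N -> nat)
    (H : forall k, 'cV[R]_(l k) -> R) (x : 'cV[R]_(stacked l)) :
  gradient (stack_sum H) x = \mxcol_k gradient (H k) (submxcol x k).
Proof.
apply/mxcolP => k; rewrite mxcolK; apply/matrixP => i j; rewrite !mxE /derive.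
(* [tagnat.Rank k i] is the position in the stack of entry [i] of block [k]. *)
have subE (h : R) k' : submxcol (h *: delta_mx (tagnat.Rank k i) 0 + x) k' =
    h *: submxcol (delta_mx (tagnat.Rank k i) 0) k' + submxcol x k'.
  by apply/matrixP => a b; rewrite !mxE.
have sub_deltak :
    submxcol (delta_mx (tagnat.Rank k i) 0 : 'cV[R]_(stacked l)) k =
    delta_mx i 0.
  apply/matrixP => a b; rewrite !mxE -!val_eqE /= tagnat.eq_Rank eqxx.
  by rewrite ?val_eqE.
have sub_delta k' : k' != k ->
    submxcol (delta_mx (tagnat.Rank k i) 0 : 'cV[R]_(stacked l)) k' = 0.
  move=> k'k; apply/matrixP => a b.
  by rewrite !mxE -val_eqE /= tagnat.eq_Rank (negbTE k'k).
have dH h : stack_sum H (h *: delta_mx (tagnat.Rank k i) 0 + x) -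
    stack_sum H x = H k (h *: delta_mx i 0 + submxcol x k) - H k (submxcol x k).
  rewrite /stack_sum -sumrB (bigD1 k) //= [X in _ + X]big1.
    by rewrite addr0 (subE h k) sub_deltak.
  by move=> k' k'k; rewrite (subE h k') sub_delta // scaler0 add0r subrr.
suff -> : (fun h => h^-1 *: ((stack_sum H \o shift x)
    (h *: delta_mx (tagnat.Rank k i) 0) - stack_sum H x)) =
  (fun h => h^-1 *: ((H k \o shift (submxcol x k))
    (h *: delta_mx i 0) - H k (submxcol x k))) by [].
by apply: funext => h; rewrite /= dH.
Qed.

(** * Products of components of one type *)

Lemma conductances_dirac (N : nat) (l : 'I_N -> nat)
    (g : forall k, 'cV[R]_(l k) -> 'cV[R]_(l k))
    fL fR (fP : 'cV[R]_(stacked l)) eL eR (eP : 'cV[R]_(stacked l)) :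
  dirac_structure (cartesian (fun k => conductance (@g k)))
    ((fL, fR, fP), (eL, eR, eP)) <-> fR = - fP /\ eR = eP.
Proof.
rewrite cartesian_dirac; split=> [Dk|[-> ->] k].
  by split; apply/mxcolP => k; have /conductance_dirac[] := Dk k;
    rewrite ?submxcolN.
by apply/conductance_dirac; rewrite submxcolN.
Qed.

Lemma inductances_dirac (N : nat) (l : 'I_N -> nat)
    (H : forall k, 'cV[R]_(l k) -> R)
    fL fR (fP : 'cV[R]_(stacked l)) eL eR (eP : 'cV[R]_(stacked l)) :
  dirac_structure (cartesian (fun k => inductance (@H k)))
    ((fL, fR, fP), (eL, eR, eP)) <-> fL = - eP /\ eL = fP.
Proof.
rewrite cartesian_dirac; split=> [Dk|[-> ->] k].
  by split; apply/mxcolP => k; have /inductance_dirac[] := Dk k;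
    rewrite ?submxcolN.
by apply/inductance_dirac; rewrite submxcolN.
Qed.

Lemma capacitances_dirac (N : nat) (l : 'I_N -> nat)
    (H : forall k, 'cV[R]_(l k) -> R)
    fL fR (fP : 'cV[R]_(stacked l)) eL eR (eP : 'cV[R]_(stacked l)) :
  dirac_structure (cartesian (fun k => capacitance (@H k)))
    ((fL, fR, fP), (eL, eR, eP)) <-> fL = - fP /\ eL = eP.
Proof.
rewrite cartesian_dirac; split=> [Dk|[-> ->] k].
  by split; apply/mxcolP => k; have /capacitance_dirac[] := Dk k;
    rewrite ?submxcolN.
by apply/capacitance_dirac; rewrite submxcolN.
Qed.

(** The external vectors have the interleaved form that [order_external] produces: block [k] holds
    the specific and then the linking variable of source [k]. *)
Lemma sources_dirac (N : nat) fL fR (fP i : 'cV[R]_N) eL eR (eP u : 'cV[R]_N) :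
  dirac_structure (cartesian (fun _ : 'I_N => source R))
    ((fL, fR, \mxcol_k col_mx (row k fP) (row k i)),
     (eL, eR, \mxcol_k col_mx (row k eP) (row k u))) <->
  fP = - i /\ eP = u.
Proof.
have rowN (x : 'cV[R]_N) k : row k (- x) = - row k x.
  by apply/matrixP => a b; rewrite !mxE.
rewrite cartesian_dirac; split=> [Dk|[-> ->] k].
  split; apply/row_matrixP => k; have /source_dirac := Dk k;
  by rewrite !mxcolK !col_mxKu !col_mxKd -?rowN => -[].
by apply/source_dirac; rewrite !mxcolK !col_mxKu !col_mxKd rowN.
Qed.

(** The left-hand side is what [cartesian_lagrange] yields for inductances and for capacitances
    alike, so one lemma serves both. *)
Lemma storage_lagrange (N : nat) (l : 'I_N -> nat)
    (H : forall k, 'cV[R]_(l k) -> R) (f e : 'cV[R]_(stacked l)) :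
  (forall k, exists a b, (submxcol f k, submxcol e k) = (a, b) /\
     b = gradient (H k) a) <-> e = gradient (stack_sum H) f.
Proof.
rewrite gradient_stack_sum; split=> [Lk|-> k].
  by apply/mxcolP => k; rewrite mxcolK; have [a [b [[-> ->]]]] := Lk k.
by exists (submxcol f k), (gradient (H k) (submxcol f k)); rewrite mxcolK.
Qed.

Lemma conductances_resistive (N : nat) (l : 'I_N -> nat)
    (g : forall k, 'cV[R]_(l k) -> 'cV[R]_(l k)) f e :
  resistive_relation (cartesian (fun k => conductance (@g k))) (f, e) <->
  - f = stack_map g e.
Proof.
rewrite cartesian_resistive; split=> [Rk|fE k].
  apply/mxcolP => k; rewrite mxcolK submxcolN.
  by have [i [u [[-> ->] <-]]] := Rk k; rewrite opprK.
exists (- submxcol f k), (submxcol e k); rewrite opprK; split=> //.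
by rewrite -submxcolN fE mxcolK.
Qed.

(** * Interconnection of the Kirchhoff system with an arbitrary system *)

Section Interconnection.
Variables (v m l r p : nat) (A : 'M[R]_(v, m)) (C : phs R l r (p + m)).

(** The Kirchhoff system has neither resistive nor specific external variables, so those of the
    interconnection are those of [C], with [0 + r] and [0 + p] read as [r] and [p]. *)
Lemma interconnect_kirchhoff_dirac j fL (fR : 'cV[R]_r) (fP : 'cV[R]_p)
    phi eL (eR : 'cV[R]_r) (eP : 'cV[R]_p) :
  dirac_structure (interconnect (kirchhoff A) C)
    ((col_mx j fL, fR, fP), (col_mx phi eL, eR, eP)) <->
  exists i u, [/\ j + A *m i = 0, A^T *m phi = u &
    dirac_structure C ((fL, fR, col_mx fP (- i)), (eL, eR, col_mx eP u))].
Proof.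
split=> [[i [u []]]|[i [u [ji uphi Ciu]]]].
  rewrite !col_mxKu !col_mxKd !dsub0mx !col0mx => /kirchhoff_dirac[ji uphi] Ciu.
  by exists i, u.
exists i, u; rewrite !col_mxKu !col_mxKd !dsub0mx !col0mx; split=> //.
exact/kirchhoff_dirac.
Qed.

Lemma interconnect_kirchhoff_lagrange q fL phi eL :
  lagrange_submanifold (interconnect (kirchhoff A) C)
    (col_mx q fL, col_mx phi eL) <->
  q = 0 /\ lagrange_submanifold C (fL, eL).
Proof. by rewrite /= !col_mxKu !col_mxKd. Qed.

Lemma interconnect_kirchhoff_resistive (f e : 'cV[R]_r) :
  resistive_relation (interconnect (kirchhoff A) C) (f, e) <->
  resistive_relation C (f, e).
Proof.
rewrite /= !dsub0mx; split=> [[]//|Cfe]; split=> //.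
by rewrite !(flatmx0 (usubmx _)).
Qed.

End Interconnection.

End Factors.

(** * The product of all components *)

Section Components.
Variables (R : realType) (NR NL NC NS : nat).
Variables (lR : 'I_NR -> nat) (lL : 'I_NL -> nat) (lC : 'I_NC -> nat).
Variable g : forall k, 'cV[R]_(lR k) -> 'cV[R]_(lR k).
Variable HL : forall k, 'cV[R]_(lL k) -> R.
Variable HC : forall k, 'cV[R]_(lC k) -> R.

Lemma components_dirac fL fC fR fS iR iL iC iS eL eC eR eS uR uL uC uS :
  dirac_structure (components NS g HL HC)
    ((col_mx fL fC, fR, col_mx fS (col_mx iR (col_mx iL (col_mx iC iS)))),
     (col_mx eL eC, eR, col_mx eS (col_mx uR (col_mx uL (col_mx uC uS))))) <->
  (fR = - iR /\ eR = uR) /\ (fL = - uL /\ eL = iL) /\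
  (fC = - iC /\ eC = uC) /\ (fS = - iS /\ eS = uS).
Proof.
(* Each pair of equations becomes membership in the product of one type, with zeros for its absent
   variables; these are the zero blocks that [order_storage] and [order_resistive] insert. *)
rewrite -(@conductances_dirac R _ _ g 0 _ _ 0).
rewrite -(@inductances_dirac R _ _ HL _ 0 _ _ 0).
rewrite -(@capacitances_dirac R _ _ HC _ 0 _ _ 0).
rewrite -(@sources_dirac R _ 0 0 _ _ 0 0).
rewrite /components /product_of_components.
apply: iff_trans (cartesian2_dirac _ _ _ _ _ _ _ _) _.
rewrite !cartesian2_dirac /order_storage /order_resistive /order_external.
rewrite -!col_mx0 !(col_mxKu, col_mxKd).
by [].
Qed.

(** The port variables determine the linking ones, which eliminates the existential quantifier. The
    two signs cancel where the flow is the negated current; the inductance current is an effort and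
    keeps the sign of [- i]. *)
Lemma components_dirac_link fL fC fR fS i eL eC eR eS u :
  dirac_structure (components NS g HL HC)
    ((col_mx fL fC, fR, col_mx fS (- i)), (col_mx eL eC, eR, col_mx eS u)) <->
  i = col_mx fR (col_mx (- eL) (col_mx fC fS)) /\
  u = col_mx eR (col_mx (- fL) (col_mx eC eS)).
Proof.
have -> : u = col_mx (usubmx u) (col_mx (usubmx (dsubmx u))
    (col_mx (usubmx (dsubmx (dsubmx u))) (dsubmx (dsubmx (dsubmx u))))).
  by rewrite !vsubmxK.
have -> : i = col_mx (usubmx i) (col_mx (usubmx (dsubmx i))
    (col_mx (usubmx (dsubmx (dsubmx i))) (dsubmx (dsubmx (dsubmx i))))).
  by rewrite !vsubmxK.
rewrite !opp_col_mx components_dirac !opprK; split.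
  by move=> [[-> ->] [[-> ->] [[-> ->] [-> ->]]]]; rewrite !opprK.
move=> [/eq_col_mx[-> /eq_col_mx[-> /eq_col_mx[-> ->]]]].
by move=> /eq_col_mx[-> /eq_col_mx[-> /eq_col_mx[-> ->]]]; rewrite !opprK.
Qed.

Lemma components_lagrange fL fC eL eC :
  lagrange_submanifold (components NS g HL HC)
    (col_mx fL fC, col_mx eL eC) <->
  eL = gradient (stack_sum HL) fL /\ eC = gradient (stack_sum HC) fC.
Proof.
rewrite -!storage_lagrange /= /order_storage !(col_mxKu, col_mxKd).
(* The factors of conductances and sources are evaluated at zero vectors, where their trivial
   relations hold. *)
rewrite !cartesian_lagrange /=; under eq_forall do rewrite !submxcol0.
under [X in _ /\ _ /\ _ /\ X]eq_forall do rewrite !submxcol0.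
by split=> [[_ [LL []]]|[]].
Qed.

Lemma components_resistive f e :
  resistive_relation (components NS g HL HC) (f, e) <-> - f = stack_map g e.
Proof.
rewrite -conductances_resistive /= /order_resistive -!col_mx0.
rewrite !(col_mxKu, col_mxKd) !(cartesian_resistive, submxcol0) /=.
split=> [[]//|Rg]; split=> //.
by do 2?[split]; move=> k /=; rewrite submxcol0.
Qed.

End Components.

(** * Block form of Kirchhoff's laws *)

(** The first block row is the current law. The other four are the voltage law on the conductances,
    inductances, capacitances and sources, in the order of the blocks of A. *)
Lemma block_equationE (R : realType) (v mR mL mC mS : nat)
    (AR : 'M[R]_(v, mR)) (AL : 'M[R]_(v, mL)) (AC : 'M[R]_(v, mC))
    (AS : 'M[R]_(v, mS)) (j phi : 'cV[R]_v) (fL eL : 'cV[R]_mL)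
    (fC eC : 'cV[R]_mC) (fR eR : 'cV[R]_mR) (fS eS : 'cV[R]_mS) :
  flow_matrix mL AR AC AS *m stack5 j fL fC fR fS +
    effort_matrix AR AL AC AS *m stack5 phi eL eC eR eS = 0 <->
  j + row_mx AR (row_mx AL (row_mx AC AS)) *m
        col_mx fR (col_mx (- eL) (col_mx fC fS)) = 0 /\
  (row_mx AR (row_mx AL (row_mx AC AS)))^T *m phi =
    col_mx eR (col_mx (- fL) (col_mx eC eS)).
Proof.
rewrite /flow_matrix /effort_matrix /row5 /stack5 !tr_row_mx.
rewrite !(mul_col_mx, mul_row_col, add_col_mx).
rewrite !(mul0mx, mul1mx, mulNmx, mulmxN, addr0, add0r).
(* Only in the inductance row does the voltage come from the flow matrix, hence before the potential
   term. *)
rewrite (addrC (- fL)).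
have eq0E m (X Y : 'cV[R]_m) : X = Y <-> - X + Y = 0.
  by rewrite addrC; split=> [->|/subr0_eq->]; rewrite ?subrr.
have col0E m n (X : 'cV[R]_m) (Y : 'cV[R]_n) :
    X = 0 /\ Y = 0 <-> col_mx X Y = 0.
  split=> [[-> ->]|]; first exact: col_mx0.
  by rewrite -col_mx0 => /eq_col_mx.
rewrite (eq0E _ _ (col_mx eR _)) col0E !opp_col_mx !add_col_mx.
(* It remains to permute the summands of the current law. *)
by rewrite -addrA (addrCA (AC *m fC)) -addrA [in X in _ <-> X](addrC (- _)).
Qed.

Theorem mainTheorem3 (R : realType)
  (* the graph and its grounded vertices *)
  (V E : finType) (G : digraph V E) (S : {set V})
  (hloop : loop_free G) (hS : one_grounded_per_component G S)
  (* the conductances, inductances, capacitances and the number of sources *)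
  (NR NL NC mS : nat)
  (lR : 'I_NR -> nat) (lL : 'I_NL -> nat) (lC : 'I_NC -> nat)
  (g : forall k, 'cV[R]_(lR k) -> 'cV[R]_(lR k))
  (HL : forall k, 'cV[R]_(lL k) -> R)
  (HC : forall k, 'cV[R]_(lC k) -> R)
  (hg : forall k u, 0 <= (u^T *m g k u) 0 0)
  (hHL : forall k, C1 (HL k)) (hHC : forall k, C1 (HC k))
  (* the correspondence between ports and edges, which orders the edges *)
  (edge : 'I_(stacked lR + (stacked lL + (stacked lC + mS))) -> E)
  (hedge : bijective edge)
  (AR : 'M[R]_(#|~: S|, stacked lR)) (AL : 'M[R]_(#|~: S|, stacked lL))
  (AC : 'M[R]_(#|~: S|, stacked lC)) (AS : 'M[R]_(#|~: S|, mS))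
  (hA : reduced_incidence G R S edge = row_mx AR (row_mx AL (row_mx AC AS))) :
  let sys : phs R (#|~: S| + (stacked lL + stacked lC)) (stacked lR) mS :=
    interconnect (kirchhoff (reduced_incidence G R S edge))
                 (components mS g HL HC) in
  [/\ dirac_structure sys =
        [set x | exists (j : 'cV[R]_#|~: S|) (uL : 'cV[R]_(stacked lL))
            (iC : 'cV[R]_(stacked lC)) (iR : 'cV[R]_(stacked lR))
            (iS : 'cV[R]_mS)
            (phi : 'cV[R]_#|~: S|) (iL : 'cV[R]_(stacked lL))
            (uC : 'cV[R]_(stacked lC)) (uR : 'cV[R]_(stacked lR))
            (uS : 'cV[R]_mS),
          x = ((col_mx j (col_mx (- uL) (- iC)), - iR, - iS),
               (col_mx phi (col_mx iL uC), uR, uS)) /\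
          flow_matrix (stacked lL) AR AC AS
            *m stack5 j (- uL) (- iC) (- iR) (- iS) +
          effort_matrix AR AL AC AS *m stack5 phi iL uC uR uS = 0],
      lagrange_submanifold sys =
        [set x | exists (q : 'cV[R]_#|~: S|) (psiL : 'cV[R]_(stacked lL))
            (qC : 'cV[R]_(stacked lC))
            (phi : 'cV[R]_#|~: S|) (iL : 'cV[R]_(stacked lL))
            (uC : 'cV[R]_(stacked lC)),
          [/\ x = (col_mx q (col_mx psiL qC), col_mx phi (col_mx iL uC)),
              q = 0, iL = gradient (stack_sum HL) psiL &
              uC = gradient (stack_sum HC) qC]] &
      resistive_relation sys =
        [set x | exists iR uR : 'cV[R]_(stacked lR),
          x = (- iR, uR) /\ iR = stack_map g uR]].
Proof.
move=> sys; split; apply/predeqP.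
- move=> [[[fL fR] fP] [[eL eR] eP]].
  rewrite -(vsubmxK fL) -(vsubmxK (dsubmx fL)) -(vsubmxK eL)
    -(vsubmxK (dsubmx eL)).
  rewrite interconnect_kirchhoff_dirac hA; split.
    move=> [i [u [ji uphi /components_dirac_link[iE uE]]]].
    (* The set is parametrized by voltages and currents whose negatives are the flows, whence the
       signs. *)
    exists (usubmx fL), (- usubmx (dsubmx fL)), (- dsubmx (dsubmx fL)), (- fR),
      (- fP), (usubmx eL), (usubmx (dsubmx eL)), (dsubmx (dsubmx eL)), eR, eP.
    by rewrite !opprK; split=> //; apply/block_equationE; rewrite -iE -uE.
  move=> [j [uL [iC [iR [iS [phi [iL [uC [uR [uS []]]]]]]]]]].
  move=> + /block_equationE[] => -[] /eq_col_mx[-> /eq_col_mx[-> ->]] -> ->.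
  move=> /eq_col_mx[-> /eq_col_mx[-> ->]] -> -> ji uphi.
  (* The linking current and voltage are read off from [ji] and [uphi] by unification. *)
  by do 2!eexists; split; [exact: ji|exact: uphi|exact/components_dirac_link].
- move=> [f e].
  rewrite -(vsubmxK f) -(vsubmxK (dsubmx f)) -(vsubmxK e) -(vsubmxK (dsubmx e)).
  rewrite interconnect_kirchhoff_lagrange components_lagrange; split.
    by move=> [-> [-> ->]]; do 6!eexists; split.
  move=> [q [psiL [qC [phi [iL [uC [[]]]]]]]].
  move=> /eq_col_mx[-> /eq_col_mx[-> ->]] /eq_col_mx[_ /eq_col_mx[-> ->]].
  by move=> -> -> ->.
- move=> [f e]; rewrite interconnect_kirchhoff_resistive components_resistive.
  split=> [fE|[iR [uR [[-> ->]]]]]; last by rewrite opprK.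
  by exists (- f), e; rewrite opprK.
Qed.
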